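(* Let $N\in\mathbb N_0$, and let $\omega,\varepsilon,\mu$ be non-zero constants, with $k=\omega\sqrt{\varepsilon\mu}$. Let $\boldsymbol J\in[\mathcal P_N]^3$ and $\rho\in\mathcal P_{N-1}$ be polynomials on $\mathbb R^3$ satisfying the charge conservation equation $\operatorname{div}\boldsymbol J-\mathrm i\omega\rho=0$ in $\mathbb R^3$. Define $$\boldsymbol A=-\mu\sum_{j\ge 0}(-1)^jk^{-2(j+1)}\Delta^j\boldsymbol J\in[\mathcal P_N]^3,\qquad \varphi=-\frac1\varepsilon\sum_{j\ge 0}(-1)^jk^{-2(j+1)}\Delta^j\rho\in\mathcal P_{N-1}$$ (finite sums, since $\Delta^j$ annihilates a given polynomial for $j$ large). Then: (i) $(\boldsymbol A,\varphi)$ is the unique pair of polynomial solutions of the Helmholtz equations $(\Delta+k^2)\boldsymbol A=-\mu\boldsymbol J$ and $(\Delta+k^2)\varphi=-\rho/\varepsilon$ in $\mathbb R^3$, and it satisfies the Lorenz gauge condition $\operatorname{div}\boldsymbol A-\mathrm i\omega\varepsilon\mu\varphi=0$ in $\mathbb R^3$. (ii) The fields $$\boldsymbol E=\mathrm i\omega\boldsymbol A-\nabla\varphi,\qquad \boldsymbol H=\frac1\mu\operatorname{rot}\boldsymbol A$$ belong to $[\mathcal P_N]^3\times[\mathcal P_{N-1}]^3$ and are the unique polynomial solution of the Maxwell system $$\mathrm i\omega\varepsilon\boldsymbol E+\operatorname{rot}\boldsymbol H=\boldsymbol J,\qquad -\mathrm i\omega\mu\boldsymbol H+\operatorname{rot}\boldsymbol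 E=\boldsymbol 0,\qquad \varepsilon\operatorname{div}\boldsymbol E=\rho,\qquad \mu\operatorname{div}\boldsymbol H=0\quad\text{in }\mathbb R^3.$$
   Context: $\mathcal P_N$ denotes the space of polynomials in three variables (complex coefficients) of total degree at most $N$, with the convention $\mathcal P_{-1}=\{0\}$. $\operatorname{rot}$ is the curl, and $\Delta$ acts componentwise on vector fields. *)

(* Defs.v *)
From HB Require Import structures.
From mathcomp Require Import all_boot all_order all_algebra.
From mathcomp Require Import boolp classical_sets functions cardinality fsbigop.
From mathcomp Require Import reals.
From mathcomp Require Import complex mpoly.

Set Implicit Arguments.
Unset Strict Implicit.
Unset Printing Implicit Defensive.

Import Order.TTheory GRing.Theory Num.Theory.

Local Open Scope ring_scope.

(* Complex-valued polynomials on R^3 are formal polynomials in three variables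
   over R[i]; an identity "in R^3" between them is equality in {mpoly R[i][3]}. *)
Notation spoly R := {mpoly R[i][3]}.

(* Finite functions rather than row vectors: they carry scaling by the complex
   scalars themselves, not by polynomials. *)
Notation vpoly R := {ffun 'I_3 -> {mpoly R[i][3]}}.

(* msize is the total degree plus one, and 0 for the zero polynomial, so that
   degree_le (-1) p means p = 0. *)
Definition degree_le (R : realType) (d : int) (p : spoly R) : Prop :=
  ((msize p)%:Z <= d + 1)%R.

Definition vdegree_le (R : realType) (d : int) (F : vpoly R) : Prop :=
  forall i, degree_le d (F i).

Definition grad (R : realType) (p : spoly R) : vpoly R :=
  [ffun i => p^`M(i)].

Definition divergence (R : realType) (F : vpoly R) : spoly R :=
  \sum_(i < 3) (F i)^`M(i).

(* Indices in 'I_3 are added modulo 3. *)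
Definition curl (R : realType) (F : vpoly R) : vpoly R :=
  [ffun i : 'I_3 => (F (i + 2))^`M(i + 1) - (F (i + 1))^`M(i + 2)].

Definition lap (R : realType) (p : spoly R) : spoly R :=
  \sum_(i < 3) p^`M(i)^`M(i).

Definition vlap (R : realType) (F : vpoly R) : vpoly R :=
  [ffun i => lap (F i)].

(* Sums over all j >= 0 with only finitely many nonzero terms; the \in bigop
   takes the value 0 if the support is infinite. *)
Definition vecpot (R : realType) (mu k : R[i]) (J : vpoly R) : vpoly R :=
  - mu *: \sum_(j \in [set: nat])
            ((-1) ^+ j * k ^- (2 * j.+1)) *: iter j (@vlap R) J.

Definition scalpot (R : realType) (eps k : R[i]) (rho : spoly R) : spoly R :=
  - eps^-1 *: \sum_(j \in [set: nat])
            ((-1) ^+ j * k ^- (2 * j.+1)) *: iter j (@lap R) rho.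

Definition helmholtz_solution (R : realType) (eps mu k : R[i])
    (J : vpoly R) (rho : spoly R) (Aphi : vpoly R * spoly R) : Prop :=
  vlap Aphi.1 + k ^+ 2 *: Aphi.1 = - mu *: J /\
  lap Aphi.2 + k ^+ 2 *: Aphi.2 = - (eps^-1 *: rho).

Definition lorenz_gauge (R : realType) (omega eps mu : R[i])
    (A : vpoly R) (phi : spoly R) : Prop :=
  divergence A - ('i%C * omega * eps * mu) *: phi = 0.

Definition maxwell_solution (R : realType) (omega eps mu : R[i])
    (J : vpoly R) (rho : spoly R) (EH : vpoly R * vpoly R) : Prop :=
  [/\ ('i%C * omega * eps) *: EH.1 + curl EH.2 = J,
      - ('i%C * omega * mu) *: EH.2 + curl EH.1 = 0,
      eps *: divergence EH.1 = rho
    & mu *: divergence EH.2 = 0].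

(* Main.v *)
Require Import Defs.
From HB Require Import structures.
From mathcomp Require Import all_boot all_order all_algebra.
From mathcomp Require Import boolp classical_sets functions cardinality fsbigop.
From mathcomp Require Import reals.
From mathcomp Require Import complex mpoly.
From mathcomp Require Import ring zify.

Set Implicit Arguments.
Unset Strict Implicit.

Import Order.TTheory GRing.Theory Num.Theory.

Local Open Scope ring_scope.

(** The Laplacian lowers the degree, so it is locally nilpotent on polynomials,
and the Helmholtz operator [lap + k^2] is a nonzero scalar plus a locally
nilpotent operator. Such an operator is bijective: a solution of
[lap u = - k^2 u] satisfies [lap^n u = (- k^2)^n u] for every [n], hence
vanishes ([helmholtz_inj]), and the Neumann series for the inverse is a finite
sum on each polynomial ([neumannP]). The two potentials are this series applied
to the charge and the current, which settles existence and uniqueness for the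
Helmholtz equations; the degree bounds hold because the series does not leave a
subspace stable under the Laplacian ([neumann_ind]).

The remaining claims follow from injectivity and the classical identities of
vector calculus. The Lorenz defect [div A - i omega eps mu phi] is killed by the
Helmholtz operator, since divergence commutes with the Laplacian and charge is
conserved, so it is zero ([lorenz_of_charge]). With the gauge condition,
[curl curl = grad div - vlap] turns the Helmholtz equations into the Maxwell
system ([maxwell_of_potentials]). Conversely, eliminating [H] from any Maxwell
solution leaves a Helmholtz equation for [E] whose right-hand side depends only
on the data ([maxwell_helmholtz]); hence [E] is unique, and Faraday's law then
determines [H] ([maxwell_unique]). *)

(** * The Helmholtz equation for a locally nilpotent operator *)

Section Neumann.

Context {K : fieldType} {V : lmodType K} (L : {linear V -> V}).
Context (L_nil : forall v, exists n, iter n L v = 0).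

(** Inverse of [L + k^2], expanded in powers of [L]:
[k^-2 (1 + k^-2 L)^-1] as a geometric series. *)
Definition neumann (k : K) (v : V) : V :=
  \sum_(j \in [set: nat]) ((-1) ^+ j * k ^- (2 * j.+1)) *: iter j L v.

Lemma neumannE (k : K) n v : iter n L v = 0 ->
  neumann k v = \sum_(j < n) ((-1) ^+ j * k ^- (2 * j.+1)) *: iter j L v.
Proof.
move=> Lnv0; rewrite (fsbig_ord _ _
  (fun j => ((-1) ^+ j * k ^- (2 * j.+1)) *: iter j L v)).
apply/esym/fsbig_widen => // j [_ /= /negP]; rewrite -leqNgt => le_nj.
rewrite /preimage /= -(subnK le_nj) iterD Lnv0.
suff -> : iter (j - n) L 0 = 0 by rewrite scaler0.
by elim: (j - n)%N => //= m ->; rewrite linear0.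
Qed.

(** Applying [L + k^2] to a partial sum telescopes, leaving [v] and a multiple
of [iter n L v], which is zero for large [n]. *)
Lemma neumannP (k : K) v : k != 0 ->
  L (neumann k v) + k ^+ 2 *: neumann k v = v.
Proof.
move=> k0; have [n Lnv0] := L_nil v; rewrite (neumannE _ Lnv0).
have partial m :
    let S := \sum_(j < m) ((-1) ^+ j * k ^- (2 * j.+1)) *: iter j L v in
    L S + k ^+ 2 *: S = v - ((-1) ^+ m * k ^- (2 * m)) *: iter m L v.
  elim: m => [|m IHm] /=.
    rewrite big_ord0 raddf0 scaler0 addr0 muln0 !expr0 invr1 mulr1.
    by rewrite scale1r subrr.
  have -> : (-1) ^+ m.+1 * k ^- (2 * m.+1) = - ((-1) ^+ m * k ^- (2 * m.+1)).
    by rewrite exprS mulN1r mulNr.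
  rewrite big_ord_recr /= linearD scalerDr addrACA IHm.
  rewrite [L (_ *: _)]linearZ scalerA.
  have -> : k ^+ 2 * ((-1) ^+ m * k ^- (2 * m.+1)) = (-1) ^+ m * k ^- (2 * m).
    by rewrite mulnS exprD; field; rewrite expf_neq0.
  by rewrite scaleNr opprK addrA addrAC subrK.
by rewrite partial Lnv0 scaler0 subr0.
Qed.

(** The difference [d] of two solutions is an eigenvector with the nonzero
eigenvalue [- k^2], unless it is zero; nilpotency on [d] rules this out. *)
Lemma helmholtz_inj (k : K) u v : k != 0 ->
  L u + k ^+ 2 *: u = L v + k ^+ 2 *: v -> u = v.
Proof.
move=> k0 eq_uv; apply/eqP; rewrite -subr_eq0; apply/eqP.
have Ld : L (u - v) = - k ^+ 2 *: (u - v).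
  apply/eqP; rewrite scaleNr -subr_eq0 opprK linearB scalerBr addrACA eq_uv.
  by rewrite -opprD subrr.
have iterd m : iter m L (u - v) = (- k ^+ 2) ^+ m *: (u - v).
  by elim: m => [|m IHm]; rewrite ?scale1r //= IHm linearZ /= Ld scalerA -exprSr.
have [n] := L_nil (u - v); rewrite iterd => /eqP.
by rewrite scaler_eq0 expf_eq0 oppr_eq0 expf_eq0 (negPf k0) !andbF => /eqP.
Qed.

(** A subspace stable under [L] is stable under [neumann]; this is how degree
bounds pass to the potentials. *)
Lemma neumann_ind (k : K) (P : V -> Prop) v :
    P 0 -> (forall x y, P x -> P y -> P (x + y)) ->
    (forall c x, P x -> P (c *: x)) -> (forall x, P x -> P (L x)) ->
  P v -> P (neumann k v).
Proof.
move=> P0 PD PZ PL Pv; have [n Lnv0] := L_nil v; rewrite (neumannE _ Lnv0).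
by apply: big_ind => // j _; apply: (PZ); elim: (nat_of_ord j) => //= m; apply: PL.
Qed.

End Neumann.

(** * Vector calculus in three variables *)

Section VectorCalculus.

Context {R : realType}.
Implicit Types (p : spoly R) (F : vpoly R).

(** Since the curl is defined by cyclic shifts of indices, expanding a sum from
an arbitrary base index [i] proves the identities below for all components at
once. *)
Lemma sum3_cyclic (V : zmodType) (G : 'I_3 -> V) i :
  \sum_(j < 3) G j = G i + G (i + 1) + G (i + 2).
Proof.
rewrite (reindex_inj (addrI i)) !big_ord_recl big_ord0 /= !addr0 addrA.
by congr (G _ + G _ + G _); apply: val_inj; case: i => [[|[|[|]]]].
Qed.

Lemma add3E (i : 'I_3) :
  (i + 1 + 1 = i + 2) * (i + 1 + 2 = i) * (i + 2 + 1 = i) * (i + 2 + 2 = i + 1).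
Proof. by do !split; apply: val_inj; case: i => [[|[|[|]]]]. Qed.

Lemma grad_linear : linear (@grad R).
Proof. by move=> c p q; apply/ffunP => i; rewrite !ffunE linearP. Qed.

HB.instance Definition _ :=
  GRing.isLinear.Build R[i] (spoly R) (vpoly R) _ (@grad R) grad_linear.

Lemma divergence_linear : linear (@divergence R).
Proof.
move=> c F G; rewrite /divergence scaler_sumr -big_split.
by apply: eq_bigr => i _; rewrite !ffunE linearP.
Qed.

HB.instance Definition _ :=
  GRing.isLinear.Build R[i] (vpoly R) (spoly R) _ (@divergence R)
    divergence_linear.

Lemma curl_linear : linear (@curl R).
Proof.
move=> c F G; apply/ffunP => i; rewrite !ffunE !mderivD !mderivZ.
by rewrite scalerBr opprD addrACA.
Qed.

HB.instance Definition _ :=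
  GRing.isLinear.Build R[i] (vpoly R) (vpoly R) _ (@curl R) curl_linear.

Lemma lap_linear : linear (@lap R).
Proof.
move=> c p q; rewrite /lap scaler_sumr -big_split.
by apply: eq_bigr => i _; rewrite !linearP.
Qed.

HB.instance Definition _ :=
  GRing.isLinear.Build R[i] (spoly R) (spoly R) _ (@lap R) lap_linear.

Lemma vlap_linear : linear (@vlap R).
Proof. by move=> c F G; apply/ffunP => i; rewrite !ffunE linearP. Qed.

HB.instance Definition _ :=
  GRing.isLinear.Build R[i] (vpoly R) (vpoly R) _ (@vlap R) vlap_linear.

Lemma divergence_grad p : divergence (grad p) = lap p.
Proof. by apply: eq_bigr => i _; rewrite ffunE. Qed.

Lemma lap_mderiv p i : lap p^`M(i) = (lap p)^`M(i).
Proof.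
rewrite /lap raddf_sum; apply: eq_bigr => j _ /=.
by rewrite (mderiv_comm i) (mderiv_comm i).
Qed.

Lemma divergence_vlap F : divergence (vlap F) = lap (divergence F).
Proof.
rewrite /divergence raddf_sum; apply: eq_bigr => i _ /=.
by rewrite ffunE lap_mderiv.
Qed.

Lemma divergence_curl F : divergence (curl F) = 0.
Proof.
rewrite /divergence (sum3_cyclic _ 0) !ffunE !add3E !add0r !linearB /=.
rewrite (mderiv_comm 1 0) (mderiv_comm 2 0) (mderiv_comm 2 1).
ring.
Qed.

Lemma curl_grad p : curl (grad p) = 0.
Proof. by apply/ffunP => i; rewrite !ffunE mderiv_comm subrr. Qed.

Lemma curl_curl F : curl (curl F) = grad (divergence F) - vlap F.
Proof.
apply/ffunP => i; rewrite !ffunE !add3E.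
rewrite /divergence /lap !(sum3_cyclic _ i) !linearB !linearD /=.
rewrite (mderiv_comm i (i + 1)) (mderiv_comm i (i + 2)).
ring.
Qed.

(** * Degrees *)

Lemma degree_leE n p : degree_le n%:Z p <-> (msize p <= n.+1)%N.
Proof. by rewrite /degree_le; split; lia. Qed.

Lemma degree_le_predE n p : degree_le (n%:Z - 1) p <-> (msize p <= n)%N.
Proof. by rewrite /degree_le; split; lia. Qed.

(** A monomial [m] of the derivative comes from the monomial [m + U_(i)] of
[p], whose degree is larger by one. *)
Lemma msize_mderiv p i : (msize p^`M(i) <= (msize p).-1)%N.
Proof.
rewrite msizeE; apply/bigmax_leqP_seq => m + _.
rewrite mcoeff_msupp mcoeff_deriv => nz.
have: (m + U_(i))%MM \in msupp p.
  by rewrite mcoeff_msupp; apply: contraNneq nz => ->; rewrite mul0rn.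
by move=> /msize_mdeg_lt; rewrite mdegD mdeg1; lia.
Qed.

Lemma msize_lap p : (msize (lap p) <= (msize p).-2)%N.
Proof.
apply: leq_trans (msize_sum _ _ _) _; apply/bigmax_leqP => i _.
by have := msize_mderiv p^`M(i) i; have := msize_mderiv p i; lia.
Qed.

Lemma iter_lap_eq0 p n : (msize p <= n)%N -> iter n (@lap R) p = 0.
Proof.
elim: n p => [|n IHn] p; first by rewrite leqn0 msize_poly_eq0 => /eqP.
by move=> ?; rewrite iterSr IHn //; have := msize_lap p; lia.
Qed.

Lemma lap_nil p : exists n, iter n (@lap R) p = 0.
Proof. by exists (msize p); apply: iter_lap_eq0. Qed.

Lemma iter_vlapE n F i : iter n (@vlap R) F i = iter n (@lap R) (F i).
Proof. by elim: n => //= n <-; rewrite ffunE. Qed.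

Lemma vlap_nil F : exists n, iter n (@vlap R) F = 0.
Proof.
exists (\max_i msize (F i))%N; apply/ffunP => i; rewrite iter_vlapE ffunE.
by apply: iter_lap_eq0; apply: leq_bigmax.
Qed.

Lemma msizeD_bound n p q :
  (msize p <= n)%N -> (msize q <= n)%N -> (msize (p + q) <= n)%N.
Proof.
by move=> pn qn; apply: leq_trans (msizeD_le _ _) _; rewrite geq_max pn.
Qed.

Lemma msizeZ_bound n c p : (msize p <= n)%N -> (msize (c *: p) <= n)%N.
Proof. by apply: leq_trans; apply: msizeZ_le. Qed.

Lemma msize_scalpot n eps k p :
  (msize p <= n)%N -> (msize (scalpot eps k p) <= n)%N.
Proof.
move=> pn; apply: msizeZ_bound.
apply: (@neumann_ind _ _ (@lap R) lap_nil k (fun p => msize p <= n)%N) => //.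
- by rewrite mmeasure0.
- by move=> *; apply: msizeD_bound.
- by move=> *; apply: msizeZ_bound.
- by move=> q qn; apply: leq_trans (msize_lap q) _; lia.
Qed.

Lemma msize_vecpot n mu k F :
    (forall i, msize (F i) <= n)%N ->
  forall i, (msize (vecpot mu k F i) <= n)%N.
Proof.
move=> Fn i; rewrite ffunE; apply: msizeZ_bound; move: i.
apply: (@neumann_ind _ _ (@vlap R) vlap_nil k
          (fun F => forall i, msize (F i) <= n)%N) => //.
- by move=> i; rewrite ffunE mmeasure0.
- by move=> G H Gn Hn i; rewrite ffunE msizeD_bound.
- by move=> c G Gn i; rewrite ffunE msizeZ_bound.
- move=> G Gn i; rewrite ffunE; apply: leq_trans (msize_lap _) _.
  by have := Gn i; lia.
Qed.

Lemma msize_curl n F :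
    (forall i, msize (F i) <= n)%N -> forall i, (msize (curl F i) <= n.-1)%N.
Proof.
move=> Fn i; rewrite ffunE; apply: msizeD_bound; rewrite ?msizeN.
  by have := msize_mderiv (F (i + 2)) (i + 1); have := Fn (i + 2); lia.
by have := msize_mderiv (F (i + 1)) (i + 2); have := Fn (i + 1); lia.
Qed.

(** * Potentials and the Maxwell system *)

Lemma vecpotP mu k F : k != 0 ->
  vlap (vecpot mu k F) + k ^+ 2 *: vecpot mu k F = - mu *: F.
Proof.
move=> k0; rewrite [vlap _]linearZ /= scalerA mulrC -scalerA -scalerDr.
by congr (_ *: _); apply: (neumannP vlap_nil).
Qed.

Lemma scalpotP eps k p : k != 0 ->
  lap (scalpot eps k p) + k ^+ 2 *: scalpot eps k p = - (eps^-1 *: p).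
Proof.
move=> k0; rewrite [lap _]linearZ /= scalerA mulrC -scalerA -scalerDr -scaleNr.
by congr (_ *: _); apply: (neumannP lap_nil).
Qed.

Lemma potentials_unique eps mu k F p Aphi1 Aphi2 : k != 0 ->
    helmholtz_solution eps mu k F p Aphi1 ->
    helmholtz_solution eps mu k F p Aphi2 ->
  Aphi1 = Aphi2.
Proof.
case: Aphi1 Aphi2 => [A1 p1] [A2 p2] k0 [/= eA1 ep1] [/= eA2 ep2].
congr (_, _); first by apply: (helmholtz_inj vlap_nil k0); rewrite eA1.
by apply: (helmholtz_inj lap_nil k0); rewrite ep1.
Qed.

(** The defect [divergence A - c phi], with [c = i omega eps mu], satisfies the
Helmholtz equation with right-hand side
[- mu (divergence F - i omega p) = 0], so [helmholtz_inj] compares it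
with the zero solution. *)
Lemma lorenz_of_charge (omega eps mu k : R[i]) F p A phi :
    k != 0 -> eps != 0 ->
    divergence F - ('i%C * omega) *: p = 0 ->
    helmholtz_solution eps mu k F p (A, phi) ->
  lorenz_gauge omega eps mu A phi.
Proof.
move=> k0 eps0 charge [/= eA ephi].
apply: (helmholtz_inj lap_nil k0).
have edivA : lap (divergence A) + k ^+ 2 *: divergence A = - mu *: divergence F.
  by rewrite -divergence_vlap -[k ^+ 2 *: _]linearZ -linearD eA linearZ.
set c := 'i%C * omega * eps * mu.
rewrite linear0 scaler0 addr0 linearB [X in _ - X]linearZ /=.
rewrite scalerBr addrACA edivA scalerA (mulrC (k ^+ 2)) -(scalerA c).
rewrite -opprD -scalerDr.
rewrite ephi scalerN opprK scalerA /c mulrAC mulfK // (mulrC _ mu).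
by rewrite -scalerA scaleNr addrC -opprB -scalerBr charge scaler0 oppr0.
Qed.

(** In Ampere's law the gauge condition cancels [grad (divergence A)] against the
gradient of [phi], leaving the Helmholtz equation for [A]; in Gauss's law it
replaces [divergence A] by a multiple of [phi], leaving the one for [phi]. The
two homogeneous equations are [curl grad = 0] and [divergence curl = 0]. *)
Lemma maxwell_of_potentials (omega eps mu k : R[i]) F p A phi :
    eps != 0 -> mu != 0 -> k ^+ 2 = omega ^+ 2 * (eps * mu) ->
    helmholtz_solution eps mu k F p (A, phi) ->
    lorenz_gauge omega eps mu A phi ->
  maxwell_solution omega eps mu F p
    (('i%C * omega) *: A - grad phi, mu^-1 *: curl A).
Proof.
move=> eps0 mu0 k2 [/= eA ephi] /eqP; rewrite subr_eq0 => /eqP divA.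
have i2 : 'i%C ^+ 2 = -1 :> R[i] by apply: sqr_i.
split=> /=.
- rewrite [curl _]linearZ /= curl_curl divA linearZ /=.
  rewrite !scalerBr !scalerA addrA.
  have -> : mu^-1 * ('i%C * omega * eps * mu) = 'i%C * omega * eps by field.
  rewrite subrK.
  have -> : 'i%C * omega * eps * ('i%C * omega) = - (mu^-1 * k ^+ 2).
    rewrite k2; transitivity ('i%C ^+ 2 * omega ^+ 2 * eps); first by ring.
    by rewrite i2; field.
  rewrite scaleNr -opprD addrC -scalerA -scalerDr eA scaleNr scalerN opprK.
  by rewrite scalerA mulVf // scale1r.
- rewrite [curl (_ - _)]linearB /= [curl (_ *: A)]linearZ /= curl_grad subr0.
  rewrite scalerA mulNr mulfK //.
  by rewrite scaleNr addNr.
- rewrite [divergence (_ - _)]linearB /= [divergence (_ *: A)]linearZ /=.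
  rewrite divergence_grad divA scalerA.
  have -> : 'i%C * omega * ('i%C * omega * eps * mu) = - k ^+ 2.
    rewrite k2; transitivity ('i%C ^+ 2 * omega ^+ 2 * (eps * mu)); first by ring.
    by rewrite i2; ring.
  by rewrite scaleNr -opprD addrC ephi opprK scalerA divff // scale1r.
- by rewrite [divergence _]linearZ /= divergence_curl !scaler0.
Qed.

(** Take the curl of Faraday's law, substitute [curl H] from Ampere's law and
[divergence E] from Gauss's law. *)
Lemma maxwell_helmholtz (omega eps mu k : R[i]) F p EH :
    eps != 0 -> k ^+ 2 = omega ^+ 2 * (eps * mu) ->
    maxwell_solution omega eps mu F p EH ->
  vlap EH.1 + k ^+ 2 *: EH.1 = grad (eps^-1 *: p) - ('i%C * omega * mu) *: F.
Proof.
move=> eps0 k2; case: EH => E H [/= ampere faraday <- _].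
have i2 : 'i%C ^+ 2 = -1 :> R[i] by apply: sqr_i.
have curlE : curl E = ('i%C * omega * mu) *: H.
  by apply/eqP; rewrite -subr_eq0 addrC -scaleNr faraday.
rewrite scalerA mulVf // scale1r -ampere scalerDr scalerA.
have -> : vlap E = grad (divergence E) - ('i%C * omega * mu) *: curl H.
  by rewrite -linearZ -curlE /= curl_curl opprB addrC subrK.
have -> : 'i%C * omega * mu * ('i%C * omega * eps) = - k ^+ 2.
  rewrite k2; transitivity ('i%C ^+ 2 * omega ^+ 2 * (eps * mu)); first by ring.
  by rewrite i2; ring.
by rewrite scaleNr opprD opprK addrAC addrA.
Qed.

Lemma maxwell_unique (omega eps mu k : R[i]) F p EH1 EH2 :
    omega != 0 -> eps != 0 -> mu != 0 -> k != 0 ->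
    k ^+ 2 = omega ^+ 2 * (eps * mu) ->
    maxwell_solution omega eps mu F p EH1 ->
    maxwell_solution omega eps mu F p EH2 ->
  EH1 = EH2.
Proof.
move=> omega0 eps0 mu0 k0 k2 sol1 sol2.
have eqE : EH1.1 = EH2.1.
  apply: (helmholtz_inj vlap_nil k0).
  by rewrite !(maxwell_helmholtz eps0 k2 (p := p) (F := F)).
case: EH1 EH2 sol1 sol2 eqE => [E1 H1] [E2 H2] [_ /= f1 _ _] [_ /= f2 _ _] eqE.
congr (_, _) => //.
have iwm0 : - ('i%C * omega * mu) != 0 :> R[i].
  by rewrite oppr_eq0 !mulf_neq0 // neq0Ci.
apply: (scalerI iwm0); apply: (@addIr _ (curl E1)).
by rewrite f1 eqE f2.
Qed.

End VectorCalculus.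

Unset Implicit Arguments.
Set Strict Implicit.

(* s is any square root of eps * mu, so no branch is singled out. *)
Theorem mainTheorem4 (R : realType) (N : nat) (omega eps mu s k : R[i])
    (omega_neq0 : omega != 0) (eps_neq0 : eps != 0) (mu_neq0 : mu != 0)
    (s_sqrt : s ^+ 2 = eps * mu) (k_def : k = omega * s)
    (J : vpoly R) (rho : spoly R)
    (J_deg : vdegree_le N%:Z J) (rho_deg : degree_le (N%:Z - 1) rho)
    (charge_conservation : divergence J - ('i%C * omega) *: rho = 0) :
  let A := vecpot mu k J in
  let phi := scalpot eps k rho in
  let E := ('i%C * omega) *: A - grad phi in
  let H := mu^-1 *: curl A in
  ([/\ vdegree_le N%:Z A,
       degree_le (N%:Z - 1) phi,
       unique (helmholtz_solution eps mu k J rho) (A, phi)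
     & lorenz_gauge omega eps mu A phi]) /\
  ([/\ vdegree_le N%:Z E,
       vdegree_le (N%:Z - 1) H
     & unique (maxwell_solution omega eps mu J rho) (E, H)]).
Proof.
move=> A phi E H.
have k2 : k ^+ 2 = omega ^+ 2 * (eps * mu) by rewrite k_def exprMn s_sqrt.
have k0 : k != 0 by rewrite -sqrf_eq0 k2 !mulf_neq0 ?expf_neq0.
have A_size i : (msize (A i) <= N.+1)%N.
  by apply: msize_vecpot => j; apply/degree_leE.
have phi_size : (msize phi <= N)%N by apply/msize_scalpot/degree_le_predE.
have sol : helmholtz_solution eps mu k J rho (A, phi).
  by split; [apply: vecpotP | apply: scalpotP].
have gauge : lorenz_gauge omega eps mu A phi.
  exact: lorenz_of_charge k0 eps_neq0 charge_conservation sol.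
have mxw : maxwell_solution omega eps mu J rho (E, H).
  exact: maxwell_of_potentials eps_neq0 mu_neq0 k2 sol gauge.
split; split=> //.
- by move=> i; apply/degree_leE.
- exact/degree_le_predE.
- by split=> // Aphi; apply: potentials_unique k0 sol.
- move=> i; apply/degree_leE.
  rewrite ffunE; apply: msizeD_bound; rewrite ffunE.
    exact/msizeZ_bound/A_size.
  by rewrite ffunE msizeN; apply: leq_trans (msize_mderiv _ _) _; lia.
- move=> i; apply/degree_le_predE.
  by rewrite ffunE; apply: msizeZ_bound; apply: msize_curl A_size _.
- split=> // EH; exact: maxwell_unique omega_neq0 eps_neq0 mu_neq0 k0 k2 mxw.
Qed.
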